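(* Let $(L,N)$ be a pair such that $L$ is a finite graph and $N$ is a subset of its vertices. The following are equivalent: 1. $\mathrm{Cone}(L,N)$ has the surjection property; 2. every edge of $L$ lies in a cycle of $L$ or in a path of $L$ starting and ending in $N$.
   Context: Paths and cycles do not visit any vertex twice (topologically a path is a line segment and a cycle is a circle); in particular a path connects two distinct vertices. For a pair $(L,N)$ (compact $L$, compact $N\subseteq L$), $\mathrm{Cone}(L,N)=(K,M)$ where $K=\mathrm{Cone}(L)$ is the quotient of $L\times[0,1]$ identifying all points $(x,0)$, and $M=L\cup\mathrm{Cone}(N)$ with $L$ embedded as $L\times\{1\}$ and $\mathrm{Cone}(N)$ the image of $N\times[0,1]$. A pair $(K,M)$ has the surjection property if every continuous $f:K\to K$ with $f|_M=\mathrm{id}_M$ is surjective.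
   Formalization: The case where L is a single vertex without edges and N is empty is excluded: there Cone(L,N) is ([0,1],{1}), the constant map 1 shows that 1 fails, while 2 holds vacuously. *)

(* Defs.v *)
From HB Require Import structures.
From mathcomp Require Import all_boot all_order all_algebra generic_quotient.
From mathcomp Require Import all_classical all_reals all_analysis.

Set Implicit Arguments.
Unset Strict Implicit.
Unset Printing Implicit Defensive.

Import Order.TTheory GRing.Theory Num.Theory.
Import numFieldNormedType.Exports.
Local Open Scope classical_set_scope.
Local Open Scope ring_scope.
Local Open Scope quotient_scope.

Definition unit_itv (R : realType) : topologicalType := `[0 : R, 1 : R]%classic.

Definition surjection_property (K : topologicalType) (M : set K) : Prop :=
  forall f : K -> K, continuous f -> (forall x, M x -> f x = x) ->
    forall y, exists x, f x = y.

Section Cone.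
Context {R : realType} (L : topologicalType).

Definition cone_rel_bool (a b : L * unit_itv R) : bool :=
  (a == b) || ((\val a.2 == 0) && (\val b.2 == 0)).

Local Lemma cone_rel_refl : reflexive cone_rel_bool.
Proof. by move=> a; rewrite /cone_rel_bool eqxx. Qed.

Local Lemma cone_rel_sym : symmetric cone_rel_bool.
Proof. by move=> a b; rewrite /cone_rel_bool eq_sym andbC. Qed.

Local Lemma cone_rel_trans : transitive cone_rel_bool.
Proof.
move=> b a c; rewrite /cone_rel_bool => /predU1P[-> //|/andP[a0 b0]].
by move=> /predU1P[<-|/andP[_ c0]]; rewrite ?a0 ?b0 ?c0 orbT.
Qed.

Definition cone_rel :=
  EquivRel cone_rel_bool cone_rel_refl cone_rel_sym cone_rel_trans.

Definition cone := {eq_quot cone_rel}.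

HB.instance Definition _ := Topological.copy cone (quotient_topology cone).
HB.instance Definition _ := Quotient.on cone.

Definition cone_base : set cone :=
  [set \pi_cone p | p in [set p : L * unit_itv R | \val p.2 = 1]].

(* For N empty this is the empty set: the apex is not adjoined. *)
Definition cone_over (N : set L) : set cone :=
  [set \pi_cone p | p in [set p : L * unit_itv R | N p.1]].

Definition cone_pair (N : set L) : set cone := cone_base `|` cone_over N.

End Cone.
Arguments cone R L : clear implicits.
Arguments cone_pair R {L} N.

(* Loops and parallel edges are allowed.  The orientation given by source and
   target only serves to parametrise the edges. *)
Record graph := Graph {
  vertex : finType;
  edge : finType;
  source : edge -> vertex;
  target : edge -> vertex
}.

Section GraphPaths.
Variable G : graph.

(* (e, true) traverses e from source to target, (e, false) backwards. *)
Definition step : Type := (edge G * bool)%type.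
Definition step_from (s : step) : vertex G :=
  if s.2 then source s.1 else target s.1.
Definition step_to (s : step) : vertex G :=
  if s.2 then target s.1 else source s.1.

Fixpoint is_walk (x : vertex G) (p : seq step) (y : vertex G) : bool :=
  if p is s :: p' then (step_from s == x) && is_walk (step_to s) p' y
  else x == y.

Definition edges_of (p : seq step) : seq (edge G) := map fst p.

Definition is_path (x : vertex G) (p : seq step) (y : vertex G) : bool :=
  [&& x != y, is_walk x p y & uniq (x :: map step_to p)].

(* Distinctness of the edges only rules out traversing one edge back and
   forth; loops and pairs of parallel edges are cycles. *)
Definition is_cycle (x : vertex G) (p : seq step) : bool :=
  [&& p != [::], is_walk x p x, uniq (map step_to p) & uniq (edges_of p)].

End GraphPaths.

Section GraphRealization.
Context {R : realType} (G : graph).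

Definition cell (i : vertex G + edge G) : topologicalType :=
  if i is inr _ then unit_itv R else discrete_topology unit.

Definition cells := {i : vertex G + edge G & cell i}.

(* The vertex to which a point of the disjoint union of cells is glued. *)
Definition cells_vertex (c : cells) : option (vertex G) :=
  match c with
  | existT (inl v) _ => Some v
  | existT (inr e) t =>
      if \val (t : unit_itv R) == 0 then Some (source e)
      else if \val (t : unit_itv R) == 1 then Some (target e)
      else None
  end.

Definition graph_rel_bool (a b : cells) : bool :=
  (a == b) || (isSome (cells_vertex a) && (cells_vertex a == cells_vertex b)).

Local Lemma graph_rel_refl : reflexive graph_rel_bool.
Proof. by move=> a; rewrite /graph_rel_bool eqxx. Qed.

Local Lemma graph_rel_sym : symmetric graph_rel_bool.
Proof.
move=> a b; rewrite /graph_rel_bool eq_sym [cells_vertex b == _]eq_sym.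
by case: (eqVneq (cells_vertex a) (cells_vertex b)) => [->|_]; rewrite ?andbF.
Qed.

Local Lemma graph_rel_trans : transitive graph_rel_bool.
Proof.
move=> b a c; rewrite /graph_rel_bool => /predU1P[-> //|/andP[va /eqP vab]].
move=> /predU1P[<-|/andP[_ /eqP <-]]; by rewrite va vab eqxx orbT.
Qed.

Definition graph_rel :=
  EquivRel graph_rel_bool graph_rel_refl graph_rel_sym graph_rel_trans.

Definition realization := {eq_quot graph_rel}.

HB.instance Definition _ :=
  Topological.copy realization (quotient_topology realization).
HB.instance Definition _ := Quotient.on realization.

Definition vertex_point (v : vertex G) : realization :=
  \pi_realization (existT cell (inl v) tt).

End GraphRealization.
Arguments realization R G : clear implicits.
Arguments vertex_point R {G} v.

(* Main.v *)
(** By compactness and connectedness only the points of the open 2-cells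
[e x (0, 1)] of the cone need care.

(2) => (1).  The cone over a cycle, or over a path with endpoints in [N], is a
disc whose boundary lies in [M] and traverses [e] once.  If [f] missed the
point [y] of the 2-cell of [e], a map from the complement of [y] to the
punctured plane, constant off that 2-cell, would make the boundary loop of the
disc both null-homotopic and of odd degree.  The contradiction comes from a
Sperner parity count on a fine grid.

(1) => (2).  If [e] lies in no such cycle or path, then [e] is a bridge from
[a] to [b] and the part [B] beyond [b] contains no vertex of [N].  On the cone
over [B], start at the apex and go first along the rim apex - a - b - apex of
the triangle over [e], then along the original ray; on the triangle,
interpolate along the rim.  This fixes [M] and misses the interior of the
triangle. *)
Require Import Defs.
From mathcomp Require Import all_boot all_order all_algebra generic_quotient.
From mathcomp Require Import all_classical all_reals all_analysis.
From mathcomp Require Import unstable ring lra.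

Set Implicit Arguments.
Unset Strict Implicit.
Unset Printing Implicit Defensive.

Import Order.TTheory GRing.Theory Num.Theory.
Import numFieldNormedType.Exports.
Local Open Scope classical_set_scope.
Local Open Scope ring_scope.
Local Open Scope quotient_scope.

(** * Cones over graphs *)

Lemma continuous_pairmap (S T U : topologicalType) (f : S -> T) (g : S -> U) :
  continuous f -> continuous g -> continuous (fun x => (f x, g x)).
Proof. by move=> cf cg x; apply: cvg_pair; [exact: cf | exact: cg]. Qed.

Lemma continuous_compose (S T U : topologicalType) (g : T -> U) (f : S -> T) :
  continuous g -> continuous f -> continuous (fun x => g (f x)).
Proof. by move=> cg cf x; apply: continuous_comp; [exact: cf | exact: cg]. Qed.

Lemma continuous_fst (S T : topologicalType) : continuous (@fst S T).
Proof. by move=> x; exact: cvg_fst. Qed.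

Lemma continuous_snd (S T : topologicalType) : continuous (@snd S T).
Proof. by move=> x; exact: cvg_snd. Qed.

(** * The unit interval as a retract of the line *)

Section UnitInterval.
Context {R : realType}.

(** Retracting onto [0, 1] lets the cells of the cone be parametrised by arbitrary reals. *)
Definition clampR (x : R) : R := Num.max 0 (Num.min 1 x).

Lemma clampR_itv x : clampR x \in (`[0, 1]%classic : set R).
Proof.
by rewrite inE /= in_itv /= /clampR le_max lexx ge_max ler01 ge_min lexx.
Qed.

Lemma clampR_id x : 0 <= x <= 1 -> clampR x = x.
Proof. by rewrite /clampR => /andP[x0 x1]; rewrite min_r // max_r. Qed.

Definition clamp (x : R) : unit_itv R := exist _ (clampR x) (clampR_itv x).

Lemma clampR_bounds x : 0 <= clampR x <= 1.
Proof. by have := clampR_itv x; rewrite inE /= in_itv. Qed.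

Lemma val_unit_itv_itv (u : unit_itv R) : 0 <= \val u <= 1.
Proof. by have := valP u; rewrite inE /= in_itv. Qed.

Lemma clampK (u : unit_itv R) : clamp (\val u) = u.
Proof.
by apply: val_inj => /=; apply: clampR_id; exact: val_unit_itv_itv.
Qed.

Lemma clamp_continuous : continuous clamp.
Proof.
apply: (@continuous_comp_initial).
move=> x; apply: (@continuous_max R R (cst 0) (cst 1 \min id)).
  exact: cvg_cst.
apply: (@continuous_min R R (cst 1) id); [exact: cvg_cst | exact: cvg_id].
Qed.

Lemma val_unit_itv_continuous : continuous (fun u : unit_itv R => \val u : R).
Proof. exact: initial_continuous. Qed.

Lemma unit_itv_compact : compact [set: unit_itv R].
Proof.
have -> : [set: unit_itv R] = clamp @` `[0, 1]%classic.
  apply/seteqP; split => // u _; exists (\val u); last exact: clampK.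
  by have := valP u; rewrite inE.
apply: continuous_compact; last exact: segment_compact.
by apply: continuous_subspaceT; exact: clamp_continuous.
Qed.

Lemma unit_itv_regular : @regular_space (unit_itv R).
Proof. exact: uniform_regular. Qed.

Lemma unit_itv_locally_compact : locally_compact [set: unit_itv R].
Proof.
move=> u _; exists [set: unit_itv R]; first by rewrite withinET; exact: filterT.
by split; [exact: unit_itv_compact | exact: closedT].
Qed.

End UnitInterval.

(** * Continuous maps out of the cone, defined cell by cell *)

Section Glue.
Context {R : realType} (G : graph).
Local Notation X := (realization R G).
Local Notation K := (cone R X).
Import ArrowAsCompactOpen.

Definition edge_point (e : edge G) (s t : R) : K :=
  \pi_K (\pi_X (existT (@cell R G) (inr e) (clamp s)), clamp t).

Definition vertex_ray (v : vertex G) (t : R) : K :=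
  \pi_K (vertex_point R v, clamp t).

Lemma edge_point_continuous e :
  continuous (fun st : R * R => edge_point e st.1 st.2).
Proof.
apply: (continuous_compose (@pi_continuous _ K)); apply: continuous_pairmap.
  apply: (continuous_compose (@pi_continuous _ X)).
  apply: (continuous_compose (@existT_continuous _ (@cell R G) (inr e))).
  exact: (continuous_compose clamp_continuous (@continuous_fst _ _)).
exact: (continuous_compose clamp_continuous (@continuous_snd _ _)).
Qed.

Lemma vertex_ray_continuous v : continuous (vertex_ray v).
Proof.
apply: (continuous_compose (@pi_continuous _ K)); apply: continuous_pairmap.
  by move=> t; exact: cvg_cst.
exact: clamp_continuous.
Qed.

Lemma edge_point_clamp e s t :
  edge_point e s t = edge_point e (clampR s) (clampR t).
Proof. by rewrite /edge_point -[clamp s]clampK -[clamp t]clampK. Qed.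

Lemma vertex_ray_clamp v t : vertex_ray v t = vertex_ray v (clampR t).
Proof. by rewrite /vertex_ray -[clamp t]clampK. Qed.

Lemma edge_point0 e t : edge_point e 0 t = vertex_ray (source e) t.
Proof.
rewrite /edge_point /vertex_ray; congr (\pi_K (_, _)).
apply/(@eqmodP _ (@graph_rel R G)); rewrite /= /graph_rel_bool /=
  clampR_id ?lexx ?ler01 //.
by rewrite eqxx /=.
Qed.

Lemma edge_point1 e t : edge_point e 1 t = vertex_ray (target e) t.
Proof.
rewrite /edge_point /vertex_ray; congr (\pi_K (_, _)).
apply/(@eqmodP _ (@graph_rel R G)); rewrite /= /graph_rel_bool /=
  clampR_id ?lexx ?ler01 //.
by rewrite oner_eq0 eqxx /=.
Qed.

Lemma cone_apex (x y : X) : \pi_K (x, clamp 0) = \pi_K (y, clamp 0).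
Proof.
apply/(@eqmodP _ (@cone_rel R X)); rewrite /= /cone_rel_bool /=
  clampR_id ?lexx ?ler01 //.
by rewrite eqxx orbT.
Qed.

Lemma edge_point_apex e s v : edge_point e s 0 = vertex_ray v 0.
Proof. exact: cone_apex. Qed.

Lemma vertex_ray_apex v w : vertex_ray v 0 = vertex_ray w 0.
Proof. exact: cone_apex. Qed.

Lemma cells_ind (P : @cells R G -> Prop) :
  (forall e s, 0 <= s <= 1 -> P (existT (@cell R G) (inr e) (clamp s))) ->
  (forall v, P (existT (@cell R G) (inl v) tt)) -> forall c, P c.
Proof.
move=> Pe Pv [[v []|e s]] //; rewrite -(clampK s); apply: Pe.
exact: val_unit_itv_itv.
Qed.

Lemma cone_ind (P : K -> Prop) :
  (forall e s t, 0 <= s <= 1 -> 0 <= t <= 1 -> P (edge_point e s t)) ->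
  (forall v t, 0 <= t <= 1 -> P (vertex_ray v t)) -> forall k, P k.
Proof.
move=> Pe Pv k; rewrite -[k]reprK; case: (repr k) => x t.
rewrite -(clampK t) -[x]reprK.
have t01 := val_unit_itv_itv t.
by elim/cells_ind: (repr x) => [e s s01|v]; [exact: Pe | exact: Pv].
Qed.

Section Elim.
Variables (Z : topologicalType).
Variables (fe : edge G -> R * R -> Z) (fv : vertex G -> R -> Z).
Hypothesis fe0 : forall e t, 0 <= t <= 1 -> fe e (0, t) = fv (source e) t.
Hypothesis fe1 : forall e t, 0 <= t <= 1 -> fe e (1, t) = fv (target e) t.
Hypothesis fea : forall e v s, 0 <= s <= 1 -> fe e (s, 0) = fv v 0.
Hypothesis fva : forall v w, fv v 0 = fv w 0.
Hypothesis fec : forall e, continuous (fe e).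
Hypothesis fvc : forall v, continuous (fv v).

(* A product of a quotient map with [0, 1] is not obviously a quotient map, so
   the second coordinate is curried into the compact-open topology. *)
Let cell_map (i : vertex G + edge G) : @cell R G i -> (unit_itv R -> Z) :=
  match i return @cell R G i -> (unit_itv R -> Z) with
  | inl v => fun _ t => fv v (\val t)
  | inr e => fun s t => fe e (\val (s : unit_itv R), \val t)
  end.

Let cells_map : @cells R G -> (unit_itv R -> Z) := sigT_fun cell_map.

Let cells_map_continuous : continuous cells_map.
Proof.
apply: sigT_continuous => -[v|e] /=.
  by move=> u; exact: cvg_cst.
pose h (p : unit_itv R * unit_itv R) := fe e (\val p.1, \val p.2).
suff hc : continuous h by exact: (continuous_curry hc).1.
apply: (continuous_compose (@fec e)); apply: continuous_pairmap.
  exact: (continuous_compose val_unit_itv_continuous (@continuous_fst _ _)).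
exact: (continuous_compose val_unit_itv_continuous (@continuous_snd _ _)).
Qed.

Let cells_map_respects (a b : @cells R G) :
  \pi_X a = \pi_X b -> cells_map a = cells_map b.
Proof.
(* A glued point takes the value prescribed at its vertex; the [None] branch is a filler that [cF]
   never meets. *)
pose F o :=
  if o is Some v then fun t : unit_itv R => fv v (\val t) else cells_map a.
have cF c : cells_vertex c -> cells_map c = F (cells_vertex c).
  case: c => -[v|e] //= s.
  case: eqP => [s0 _|_].
    apply/funext => t /=.
    by rewrite /cells_map /sigT_fun /= s0 fe0 // val_unit_itv_itv.
  case: eqP => [s1 _|_ //]; apply/funext => t /=.
  by rewrite /cells_map /sigT_fun /= s1 fe1 // val_unit_itv_itv.
move/(@eqmodP _ (@graph_rel R G)); rewrite /= /graph_rel_bool.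
move=> /predU1P[->//|/andP[va /eqP ab]].
by rewrite (cF a) // (cF b) -ab.
Qed.

Let rmap (x : X) : unit_itv R -> Z := cells_map (repr x).

Let rmapE c : rmap (\pi_X c) = cells_map c.
Proof. by apply: cells_map_respects; rewrite reprK. Qed.

Let rmap_continuous : continuous rmap.
Proof.
apply/quotient_continuous.
have -> : rmap \o \pi_X = cells_map by apply/funext => c /=; exact: rmapE.
exact: cells_map_continuous.
Qed.

(** Uncurrying keeps continuity because [0, 1] is locally compact and regular. *)
Let umap_continuous : continuous (uncurry rmap).
Proof.
apply: continuous_uncurry_regular.
- exact: unit_itv_locally_compact.
- exact: unit_itv_regular.
- exact: rmap_continuous.
- move=> x; rewrite /rmap; case: (repr x) => -[v|e] /= s.
    exact: (continuous_compose (@fvc v) val_unit_itv_continuous).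
  apply: (continuous_compose (@fec e)).
  apply: (@continuous_pairmap _ _ _ (cst (\val s : R))).
    exact: cst_continuous.
  exact: val_unit_itv_continuous.
Qed.

(** The map descends through two quotients: to the graph by agreement at the ends of the edges, then
    to the cone by constancy at level 0. *)
Lemma glue_cone : exists f : K -> Z,
  [/\ continuous f,
      forall e s t, 0 <= s <= 1 -> 0 <= t <= 1 ->
        f (edge_point e s t) = fe e (s, t) &
      forall v t, 0 <= t <= 1 -> f (vertex_ray v t) = fv v t].
Proof.
have rmap_apex (x : X) (t : unit_itv R) v : \val t = 0 -> rmap x t = fv v 0.
  rewrite /rmap; case: (repr x) => -[w|e] /= s t0;
    rewrite /cells_map /sigT_fun /= t0.
    exact: fva.
  by apply: fea; exact: val_unit_itv_itv.
have fE p : uncurry rmap (repr (\pi_K p)) = uncurry rmap p.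
  have /(@eqmodP _ (@cone_rel R X)) : \pi_K (repr (\pi_K p)) = \pi_K p.
    by rewrite reprK.
  rewrite /= /cone_rel_bool => /predU1P[->//|/andP[]].
  case: (repr _) => x t; case: p => y u /= /eqP t0 /eqP u0.
  (* The common value at level 0 is named through a vertex, and any point of the graph supplies
     one. *)
  have [v _] : exists v : vertex G, true.
    by case: (repr x) => -[v|e] _; [exists v | exists (source e)].
  by rewrite (rmap_apex x t v) // (rmap_apex y u v).
exists (uncurry rmap \o repr); split.
- apply/quotient_continuous.
  have -> : (uncurry rmap \o repr) \o \pi_K = uncurry rmap.
    by apply/funext => p /=; exact: fE.
  exact: umap_continuous.
- move=> e s t s01 t01; rewrite /= fE /= rmapE /cells_map /sigT_fun /=.
  by rewrite !clampR_id.
- by move=> v t t01; rewrite /= fE /= rmapE /cells_map /sigT_fun /= clampR_id.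
Qed.

End Elim.
End Glue.
Section Pair.
Context {R : realType} {G : graph}.
Variable N : {set vertex G}.
Local Notation X := (realization R G).
Local Notation K := (cone R X).
Local Notation M :=
  (cone_pair R [set vertex_point R v | v in [set v | v \in N]]).

Lemma edge_point_in_pair e s : M (edge_point e s 1).
Proof.
left; exists (\pi_X (existT (@cell R G) (inr e) (clamp s)), clamp 1) => //=.
by rewrite clampR_id ?lexx ?ler01.
Qed.

Lemma vertex_ray_in_pair v t : (v \in N) || (t == 1) -> M (vertex_ray v t).
Proof.
case/orP=> [vN|/eqP->].
  by right; exists (vertex_point R v, clamp t) => //; exists v.
by left; exists (vertex_point R v, clamp 1) => //=;
  rewrite clampR_id ?lexx ?ler01.
Qed.

Lemma cone_pair_ind (P : K -> Prop) :
  (forall e s, 0 <= s <= 1 -> P (edge_point e s 1)) ->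
  (forall v t, 0 <= t <= 1 -> (v \in N) || (t == 1) -> P (vertex_ray v t)) ->
  forall k, M k -> P k.
Proof.
move=> Pe Pv k [[[x t] /= t1 <-]|[[x t] /= [v vN <-] <-]].
  have -> : t = clamp 1 by rewrite -t1 clampK.
  rewrite -[x]reprK.
  elim/(@cells_ind R): (repr x) => [e s s01|v]; first exact: Pe.
  by apply: Pv; rewrite ?eqxx ?orbT ?lexx ?ler01.
rewrite -(clampK t); apply: Pv; last by rewrite vN.
exact: val_unit_itv_itv.
Qed.

End Pair.

(** * A parity argument in the plane *)

Section GridParity.
Variables (n : nat) (A B : nat -> nat -> bool).

Let cross i j k l := (A i j && B k l) || (B i j && A k l).
Let square (P : nat -> nat -> bool) i j :=
  [&& P i j, P i.+1 j, P i j.+1 & P i.+1 j.+1].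

Hypothesis disj : forall i j, ~~ (A i j && B i j).
Hypothesis two_labels : forall i j, (i < n)%N -> (j < n)%N ->
  [|| square (fun i j => ~~ A i j) i j, square (fun i j => ~~ B i j) i j
    | square (fun i j => A i j || B i j) i j].
Hypothesis periodic : forall j, (j <= n)%N -> A 0 j = A n j /\ B 0 j = B n j.
Hypothesis bottom : forall i, (i <= n)%N -> A i 0 = A 0 0 /\ B i 0 = B 0 0.

(* A closed walk around a square meeting at most two labels crosses between
   A and B an even number of times. *)
Let cross_square i j : (i < n)%N -> (j < n)%N ->
  cross i j i.+1 j (+) cross i j.+1 i.+1 j.+1
  = cross i j i j.+1 (+) cross i.+1 j i.+1 j.+1.
Proof.
move=> ilt jlt; have := two_labels ilt jlt; rewrite /square /cross.
have := disj i j; have := disj i.+1 j; have := disj i j.+1.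
have := disj i.+1 j.+1.
case: (A i j); case: (A i.+1 j); case: (A i j.+1); case: (A i.+1 j.+1);
case: (B i j); case: (B i.+1 j); case: (B i j.+1); case: (B i.+1 j.+1) => //.
Qed.

(** Summed along a row, [cross_square] telescopes to the two outer sides, which cancel by
    periodicity. So all rows have the parity of the bottom row, whose labels are constant. *)
Lemma top_crossings_even :
  \big[addb/false]_(i < n) ((A i n && B i.+1 n) || (B i n && A i.+1 n)) = false.
Proof.
have row j : (j < n)%N -> \big[addb/false]_(i < n) cross i j i.+1 j
    = \big[addb/false]_(i < n) cross i j.+1 i.+1 j.+1.
  move=> jlt.
  have H m : (m <= n)%N -> \big[addb/false]_(i < m) cross i j i.+1 j
      (+) \big[addb/false]_(i < m) cross i j.+1 i.+1 j.+1
      = cross 0 j 0 j.+1 (+) cross m j m j.+1.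
    elim: m => [|m IH] mn; first by rewrite !big_ord0 /= addbb.
    rewrite !big_ord_recr /= addbACA IH ?(ltnW mn) // cross_square //.
    by rewrite addbA addbK.
  have := H n (leqnn _); rewrite /cross.
  have [<- <-] := periodic (ltnW jlt); have [<- <-] := periodic jlt.
  by rewrite addbb; do 2 case: (\big[_/_]_(_ < _) _).
have all j : (j <= n)%N -> \big[addb/false]_(i < n) cross i j i.+1 j = false.
  elim: j => [|j IH] jn; last by rewrite -row // IH // ltnW.
  apply: big1 => i _; rewrite /cross.
  have [-> ->] := bottom (ltnW (ltn_ord i)); have [-> ->] := bottom (ltn_ord i).
  by have := disj 0 0; case: (A 0 0); case: (B 0 0).
exact: all.
Qed.

End GridParity.

(** * Winding of a loop in the punctured plane *)

Section PlaneDegree.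
Context {R : realType}.
Variables (g1 g2 : R * R -> R) (p0 : R).
Hypothesis cg1 : continuous g1.
Hypothesis cg2 : continuous g2.

(** The open upper half-plane is cut along the positive vertical half-axis, so changes between [A]
    and [B] count crossings of that half-axis. *)
Let A x := (0 < g2 x) && (g1 x < 0).
Let B x := (0 < g2 x) && (0 <= g1 x).

Let avoids (P : R * R -> bool) (x : R * R) (d : R) :=
  forall y, ball x d y -> ~~ P y.

(* The third label is the half-plane [g2 <= 0]. *)
Let few_labels x d := [\/ avoids A x d, avoids B x d |
  avoids (fun y => ~~ (A y || B y)) x d].

Let continuous_pos (g : R * R -> R) x : continuous g -> 0 < g x ->
  exists2 d : R, 0 < d & forall y, ball x d y -> 0 < g y.
Proof.
move=> cg gx; have : nbhs x (g @^-1` [set r | 0 < r]).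
  by apply: cg; apply: open_nbhs_nbhs; split => //; exact: open_gt.
by move=> /nbhs_ballP[d d0 dP]; exists d.
Qed.

(** A strict sign is an open condition: [g2 < 0] excludes [A], [g2 > 0] excludes the third label,
    and on the horizontal axis the sign of [g1] excludes [A] or [B]. *)
Let few_labels_local x : ~ (g1 x = 0 /\ g2 x = 0) ->
  exists2 d, 0 < d & few_labels x d.
Proof.
have cN (g : R * R -> R) : continuous g -> continuous (fun y => - g y).
  by move=> cg y; apply: cvgN; exact: cg.
move=> nz; case: (ltrgtP (g2 x) 0) => g2x.
- have [|d d0 dP] := continuous_pos (cN _ cg2) (x := x).
    by rewrite oppr_gt0.
  by exists d => //; apply: Or31 => y /dP; rewrite /A oppr_gt0; case: ltrgtP.
- have [d d0 dP] := continuous_pos cg2 g2x.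
  exists d => //; apply: Or33 => y /dP; rewrite /A /B => -> /=.
  by case: ltP.
case: (ltrgtP (g1 x) 0) => g1x; last by case: nz.
- have [|d d0 dP] := continuous_pos (cN _ cg1) (x := x).
    by rewrite oppr_gt0.
  exists d => //; apply: Or32 => y /dP; rewrite /B oppr_gt0.
  by case: ltrgtP; rewrite ?andbF.
- have [d d0 dP] := continuous_pos cg1 g1x.
  by exists d => //; apply: Or31 => y /dP; rewrite /A; case: ltrgtP; rewrite ?andbF.
Qed.

Hypothesis nozero : forall s t, 0 <= s <= 1 -> 0 <= t <= 1 ->
  ~ (g1 (s, t) = 0 /\ g2 (s, t) = 0).

(** A Lebesgue number argument on the compact square. The radius is twice the mesh of the grid, so
    that the open ball around a grid point contains its neighbours. *)
Let few_labels_uniform :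
  \forall n \near \oo, forall s t, 0 <= s <= 1 -> 0 <= t <= 1 ->
    few_labels (s, t) (2 / n.+1%:R).
Proof.
have cQ : compact (`[0 : R, 1]%classic `*` `[0 : R, 1]%classic).
  by apply: compact_setX; exact: segment_compact.
have /compact_near_coveringP cov := cQ.
have := cov nat \oo (fun n x => few_labels x (2 / n.+1%:R)) _.
move=> H; have {H} : \forall n \near \oo,
    `[0 : R, 1]%classic `*` `[0 : R, 1]%classic
    `<=` (fun x => few_labels x (2 / n.+1%:R)).
  apply: H => -[s t] [/= s01 t01].
  have [|d d0 dP] := @few_labels_local (s, t).
    by apply: nozero; [move: s01 | move: t01]; rewrite in_itv.
  have d2 : 0 < d / 2 by rewrite divr_gt0.
  have d4 : 0 < d / 4 by rewrite divr_gt0.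
  near=> x n.
  have xn : ball (s, t) (d / 2) x by near: x; exact: nbhsx_ballx.
  have nn : n.+1%:R^-1 < d / 4.
    by near: n; exact: (near_infty_natSinv_lt (PosNum d4)).
  have sub y : ball x (2 / n.+1%:R) y -> ball (s, t) d y.
    move=> /(ball_triangle xn); apply: le_ball.
    by move: (n.+1%:R^-1) nn => q; lra.
  by case: dP => H; [apply: Or31|apply: Or32|apply: Or33] => y /sub /H.
apply: filterS => n H s t s01 t01; apply: H.
by split; rewrite /= in_itv.
Unshelve. all: by end_near.
Qed.

Hypothesis periodic1 : forall t, 0 <= t <= 1 -> g1 (0, t) = g1 (1, t).
Hypothesis periodic2 : forall t, 0 <= t <= 1 -> g2 (0, t) = g2 (1, t).
Hypothesis bottom1 : forall s, 0 <= s <= 1 -> g1 (s, 0) = g1 (0, 0).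
Hypothesis bottom2 : forall s, 0 <= s <= 1 -> g2 (s, 0) = g2 (0, 0).
Hypothesis p01 : 0 < p0 < 1.
Hypothesis top_pos : 0 < g2 (p0, 1).
Hypothesis top_left : forall s, 0 <= s < p0 -> 0 < g2 (s, 1) -> g1 (s, 1) < 0.
Hypothesis top_right : forall s, p0 <= s <= 1 -> 0 < g2 (s, 1) -> 0 <= g1 (s, 1).

(** The top row changes between [A] and [B] exactly once, at [p0], while the parity count makes the
    number of changes even. *)
Lemma winding_absurd : False.
Proof.
(* A mesh below [d] keeps [g2] positive at the two grid points around [p0], so the change there is
   recorded. *)
have [d d0 dP] := continuous_pos cg2 top_pos.
near \oo => n.
have nd : n.+1%:R^-1 < d by near: n; exact: (near_infty_natSinv_lt (PosNum d0)).
have few s t : 0 <= s <= 1 -> 0 <= t <= 1 -> few_labels (s, t) (2 / n.+1%:R).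
  move: s t; near: n; exact: few_labels_uniform.
pose x i : R := i%:R / n.+1%:R.
have x01 i : (i <= n.+1)%N -> 0 <= x i <= 1.
  by move=> ni; rewrite divr_ge0 //= ler_pdivrMr // mul1r ler_nat.
have xS i : x i.+1 = x i + n.+1%:R^-1 by rewrite /x -addn1 natrD mulrDl mul1r.
have x0 : x 0 = 0 by rewrite /x mul0r.
have xn : x n.+1 = 1 by rewrite /x divff.
have q0 : 0 < n.+1%:R^-1 :> R by rewrite invr_gt0.
have step (u v : R) : (v = u) \/ (v = u + n.+1%:R^-1) -> ball u (2 / n.+1%:R) v.
  rewrite /ball /= /ball_ => H; move: q0; rewrite -[2 / _]/(2 * n.+1%:R^-1).
  by case: H => ->; rewrite ltr_norml; move: n.+1%:R^-1 => q *; apply/andP; lra.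
pose a i j := A (x i, x j); pose b i j := B (x i, x j).
have disj i j : ~~ (a i j && b i j).
  by rewrite /a /b /A /B [g1 _ < 0]ltNge; case: (0 < g2 _); case: (0 <= g1 _).
have few2 i j : (i < n.+1)%N -> (j < n.+1)%N ->
    [|| [&& ~~ a i j, ~~ a i.+1 j, ~~ a i j.+1 & ~~ a i.+1 j.+1],
        [&& ~~ b i j, ~~ b i.+1 j, ~~ b i j.+1 & ~~ b i.+1 j.+1]
      | [&& a i j || b i j, a i.+1 j || b i.+1 j, a i j.+1 || b i j.+1
          & a i.+1 j.+1 || b i.+1 j.+1]].
  move=> im jm; have := few (x i) (x j) (x01 _ (ltnW im)) (x01 _ (ltnW jm)).
  have near_pt u v : u = i \/ u = i.+1 -> v = j \/ v = j.+1 ->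
      ball (x i, x j) (2 / n.+1%:R) (x u, x v).
    by move=> [->|->] [->|->]; split; apply: step; rewrite ?xS /=; auto.
  case=> H; apply/or3P; [apply: Or31|apply: Or32|apply: Or33]; apply/and4P.
  - by split; apply: H; apply: near_pt; auto.
  - by split; apply: H; apply: near_pt; auto.
  - by split; apply: negbNE; apply: H; apply: near_pt; auto.
have per j : (j <= n.+1)%N -> a 0 j = a n.+1 j /\ b 0 j = b n.+1 j.
  by move=> jn; rewrite /a /b /A /B x0 xn (periodic1 (x01 _ jn)) (periodic2 (x01 _ jn)).
have bot i : (i <= n.+1)%N -> a i 0 = a 0 0 /\ b i 0 = b 0 0.
  by move=> ni; rewrite /a /b /A /B x0 (bottom1 (x01 _ ni)) (bottom2 (x01 _ ni)).
have := top_crossings_even disj few2 per bot.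
move/eqP; apply/negP; rewrite /a /b xn.
(* The least grid index at or beyond [p0] is positive; written [k.+1], it makes column [k] the one
   that straddles [p0]. *)
have ex : exists i, p0 <= x i by exists n.+1; rewrite xn; case/andP: p01 => _ /ltW.
case: (ex_minnP ex) => -[|k]; first by rewrite x0 leNgt; case/andP: p01 => ->.
move=> pk kmin.
have kp : x k < p0 by rewrite ltNge; apply/negP => /kmin; rewrite ltnn.
have kn : (k < n.+1)%N.
  by apply: kmin; rewrite xn; case/andP: p01 => _ /ltW.
have mono i j : (i <= j)%N -> x i <= x j.
  by move=> ij; rewrite ler_pM2r // ler_nat.
rewrite (bigD1 (Ordinal kn)) //= big1 => [|i /eqP ik].
  have pos u : `|p0 - u| <= n.+1%:R^-1 -> 0 < g2 (u, 1).
    move=> pu; apply: dP; split; rewrite /ball /= /ball_ ?subrr ?normr0 //.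
    exact: le_lt_trans nd.
  have k1 := x01 _ kn; have k0 := x01 _ (ltnW kn).
  have kS := xS k.
  have gk : 0 < g2 (x k, 1).
    apply: pos; rewrite ler_norml; apply/andP; move: n.+1%:R^-1 kS q0 => q *; lra.
  rewrite /A /B gk top_left //; last by rewrite kp andbT; case/andP: k0.
  have gk1 : 0 < g2 (x k.+1, 1).
    apply: pos; rewrite ler_norml; apply/andP; move: n.+1%:R^-1 kS q0 => q *; lra.
  by rewrite gk1 top_right // pk; case/andP: k1.
have ik' : (i : nat) <> k by move=> h; apply: ik; apply: val_inj.
rewrite /A /B.
case: (ltP 0 (g2 (x i, 1))) => //= gi.
case: (ltP 0 (g2 (x i.+1, 1))) => //= gi1; last by rewrite !andbF.
have i0 := x01 _ (ltnW (ltn_ord i)); have i1 := x01 _ (ltn_ord i).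
(* Any other column lies on one side of [p0], where only one of the two labels can occur. *)
case: (ltngtP i k) => // [ik1|ki].
  have xi1 : x i.+1 < p0 by apply: le_lt_trans kp; exact: mono.
  have xi : x i < p0 by apply: le_lt_trans xi1; exact: mono.
  have L : g1 (x i, 1) < 0 by apply: top_left; rewrite ?xi ?andbT //; case/andP: i0.
  have L1 : g1 (x i.+1, 1) < 0.
    by apply: top_left; rewrite ?xi1 ?andbT //; case/andP: i1.
  by rewrite !leNgt L L1.
have xi : p0 <= x i by apply: le_trans pk _; exact: mono.
have xi1 : p0 <= x i.+1 by apply: le_trans xi _; exact: mono.
have L : 0 <= g1 (x i, 1) by apply: top_right; rewrite ?xi //; case/andP: i0.
have L1 : 0 <= g1 (x i.+1, 1).
  by apply: top_right; rewrite ?xi1 //; case/andP: i1.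
by rewrite !ltNge L L1.
Unshelve. all: by end_near.
Qed.

End PlaneDegree.

(** * Walks *)

Section Walks.
Variable G : graph.
Implicit Types (x y : vertex G) (p q : seq (step G)) (e : edge G).

Lemma is_walk_cat x p q y :
  is_walk x (p ++ q) y = [exists z, is_walk x p z && is_walk z q y].
Proof.
elim: p x => [|s p IH] x /=.
  apply/idP/existsP => [w|[z /andP[/eqP-> //]]]; by exists x; rewrite eqxx.
rewrite IH; apply/andP/existsP => [[sx /existsP[z w]]|[z /andP[/andP[sx w] w']]].
  by exists z; rewrite sx.
by split=> //; apply/existsP; exists z; rewrite w.
Qed.

Lemma edges_of_cat p q : edges_of (p ++ q) = edges_of p ++ edges_of q.
Proof. exact: map_cat. Qed.

Lemma walk_edge_end x p y e : is_walk x p y -> e \in edges_of p ->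
  (source e \in map (@step_to G) p) || (target e \in map (@step_to G) p).
Proof.
elim: p x => //= -[e' o] p IH x /andP[_ w]; rewrite !inE /= => /predU1P[->|ep].
  by case: o {IH w}; rewrite /step_to /= eqxx ?orbT.
by case/orP: (IH _ w ep) => ->; rewrite ?orbT.
Qed.

(** If the first edge recurred, one of its two ends would be entered again by a later step. *)
Lemma uniq_walk_edges x p y :
  is_walk x p y -> uniq (x :: map (@step_to G) p) -> uniq (edges_of p).
Proof.
elim: p x => //= -[e o] p IH x /andP[/eqP sx w]; rewrite inE negb_or.
move=> /andP[/andP[_ xp] /andP[sp up]]; rewrite (IH _ w) /= ?sp //= andbT.
apply/negP => /(walk_edge_end w); move: sx sp.
by case: o {w}; rewrite /step_to /step_from /= => -> /negPf->; rewrite (negPf xp).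
Qed.

Section Avoid.
Variable e : edge G.

(** Adjacency in the graph with [e] deleted. *)
Definition avoiding_adjacent : rel (vertex G) := fun x y =>
  [exists s : edge G * bool,
    [&& s.1 != e, step_from (s : step G) == x & step_to (s : step G) == y]].

Lemma avoiding_adjacent_sym : symmetric avoiding_adjacent.
Proof.
suff H x y : avoiding_adjacent x y -> avoiding_adjacent y x.
  by move=> x y; apply/idP/idP; exact: H.
move=> /existsP[[e' o] /and3P[/= ne sx sy]]; apply/existsP; exists (e', ~~ o).
by apply/and3P; split=> //=; case: o sx sy.
Qed.

Lemma avoiding_connect x y : connect avoiding_adjacent x y ->
  exists p, [/\ is_walk x p y, uniq (x :: map (@step_to G) p),
    e \notin edges_of p &
    {subset map (@step_to G) p <= connect avoiding_adjacent x}].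
Proof.
move=> /connectP[q0 pq0 ->]; case/shortenP: pq0 => q pq uq _ {q0}.
suff [p [w pE ep]] : exists p, [/\ is_walk x p (last x q),
    map (@step_to G) p = q & e \notin edges_of p].
  exists p; split=> //; rewrite pE // => z zq.
  by apply: (path_connect pq); rewrite inE zq orbT.
elim: q x {uq} pq => [|z q IH] x /=; first by exists [::]; rewrite /= eqxx.
move=> /andP[/existsP[s /and3P[se sx /eqP sz]] /IH[p [w pE ep]]].
exists ((s : step G) :: p); split; rewrite /= ?sz ?pE //; first by rewrite sx.
by rewrite inE negb_or eq_sym se.
Qed.

(** The component of the head of [(e, o)] once [e] is deleted. *)
Definition side (o : bool) : {set vertex G} :=
  [set v | connect avoiding_adjacent (step_to ((e, o) : step G)) v].

Lemma side_closed o e' : e' != e -> (source e' \in side o) = (target e' \in side o).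
Proof.
move=> ne; rewrite !inE; apply: same_connect_r.
  exact: sym_connect_sym avoiding_adjacent_sym.
apply: connect1; apply/existsP; exists (e', true); by rewrite ne !eqxx.
Qed.

(** If the tail of [e] is still reachable from its head without [e], that return path closes up with
    [e] to a cycle. *)
Lemma cycle_or_side o :
  (exists x p, is_cycle x p /\ e \in edges_of p) \/
  step_from ((e, o) : step G) \notin side o.
Proof.
case: (boolP (_ \in _)); last by right.
rewrite inE => /avoiding_connect[p [w u ep _]]; left.
exists (step_from ((e, o) : step G)), (((e, o) : step G) :: p); split.
  rewrite /is_cycle /= eqxx w; move: (u) => /= ->; rewrite ep /=.
  exact: (uniq_walk_edges w u).
by rewrite inE eqxx.
Qed.

(** When no cycle arises, [e] is a bridge. If both sides meet [N], a path on each side joined by [e]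
    runs from [N] to [N]; its vertices are distinct because the sides are disjoint. *)
Lemma bridge_side (N : {set vertex G}) :
  [\/ exists x p, is_cycle x p /\ e \in edges_of p,
      exists x y p, [/\ x \in N, y \in N, is_path x p y & e \in edges_of p] |
      exists o, step_from ((e, o) : step G) \notin side o /\
        forall v, v \in N -> v \notin side o].
Proof.
case: (cycle_or_side true) => [|at_]; first by constructor 1.
case: (cycle_or_side false) => [|af]; first by constructor 1.
have [[x [xN xs]]|N1] := pselect (exists v, v \in N /\ v \in side false); last first.
  constructor 3; exists false; split=> // v vN; apply/negP => vs.
  by apply: N1; exists v.
have [[y [yN ys]]|N2] := pselect (exists v, v \in N /\ v \in side true); last first.
  constructor 3; exists true; split=> // v vN; apply/negP => vs.
  by apply: N2; exists v.
have csym := sym_connect_sym avoiding_adjacent_sym.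
have cy : connect avoiding_adjacent (target e) y by rewrite inE in ys.
have cx : connect avoiding_adjacent x (source e) by rewrite csym; rewrite inE in xs.
have sep z : connect avoiding_adjacent x z ->
    connect avoiding_adjacent (target e) z -> False.
  move=> xz tz; move: at_; rewrite inE /= => /negP; apply.
  by apply: connect_trans tz _; rewrite csym; apply: connect_trans xz; rewrite csym.
have [q [wq uq eq sq]] := avoiding_connect cy.
have [p [wp up ep sp]] := avoiding_connect cx.
constructor 2; exists x, y, (p ++ ((e, true) : step G) :: q); split=> //; last first.
  by rewrite edges_of_cat mem_cat /= inE eqxx orbT.
apply/and3P; split.
- by apply/eqP => xy; apply: (sep y) => //; rewrite xy.
- rewrite is_walk_cat; apply/existsP; exists (source e).
  by rewrite wp /= eqxx.
- rewrite map_cat -cat_cons cat_uniq; apply/and3P; split=> //.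
  apply/hasPn => z zq; apply/negP => zp; apply: (sep z).
    by move: zp; rewrite inE => /predU1P[->//|/sp].
  by move: zq; rewrite inE => /predU1P[->|/sq].
Qed.

End Avoid.

(** Cycles and paths are merged into one kind of walk: the disc argument uses only distinct edges
    and the condition on the ends. *)
Lemma cycle_or_path_walk (N : {set vertex G}) e :
  (exists x p, is_cycle x p /\ e \in edges_of p) \/
  (exists x y p, [/\ x \in N, y \in N, is_path x p y & e \in edges_of p]) ->
  exists x y p, [/\ is_walk x p y, e \in edges_of p, uniq (edges_of p) &
    x = y \/ (x \in N /\ y \in N)].
Proof.
case=> [[x [p [/and4P[_ w _ u] ep]]]|[x [y [p [xN yN /and3P[_ w u] ep]]]]].
  by exists x, x, p; split=> //; left.
by exists x, y, p; split=> //; [exact: uniq_walk_edges w u | right].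
Qed.

Lemma edges_of_split e p : e \in edges_of p -> uniq (edges_of p) ->
  exists p1 o p2, [/\ p = p1 ++ ((e, o) : step G) :: p2,
    e \notin edges_of p1 & e \notin edges_of p2].
Proof.
elim: p => //= -[e' o] p IH; rewrite inE /= => /predU1P[<-|ep] /andP[e'p u].
  by exists [::], o, p.
have [p1 [d [p2 [pE pl pr]]]] := IH ep u; subst p.
exists ((e', o) :: p1), d, p2; split=> //=; rewrite inE negb_or pl andbT.
by apply: contraNN e'p => /eqP<-.
Qed.

End Walks.

(** * Maps on cones *)

Lemma continuous_paste (R : realType) (S T : topologicalType) (u : S -> R)
    (f g : S -> T) :
  continuous u -> continuous f -> continuous g ->
  (forall x, u x = 0 -> f x = g x) ->
  continuous (fun x => if u x <= 0 then f x else g x).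
Proof.
move=> cu cf cg fg x U; rewrite /= nbhs_simpl /=.
have cuP (P : set R) : open P -> P (u x) -> nbhs x (u @^-1` P).
  by move=> oP Pu; apply: cu; exact: open_nbhs_nbhs.
have Uf : nbhs (f x) U -> nbhs x (f @^-1` U) by exact: cf.
have Ug : nbhs (g x) U -> nbhs x (g @^-1` U) by exact: cg.
case: (ltrgtP (u x) 0) => ux nU.
- have := cuP [set r | r < 0] (@open_lt _ 0) ux; apply: filterS2 (Uf nU) => z /=.
  by move=> + uz; rewrite (ltW uz).
- have := cuP [set r | 0 < r] (@open_gt _ 0) ux; apply: filterS2 (Ug nU) => z /=.
  by move=> + uz; rewrite leNgt uz.
- apply: filterS2 (Uf nU) (Ug _) => [z /=|]; first by case: ifP.
  by rewrite -fg.
Qed.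

Section ConeMaps.
Context {R : realType} {G : graph}.
Local Notation K := (cone R (realization R G)).
Implicit Types (e : edge G) (v : vertex G) (s t : R) (st : step G).

(** Extension by zero is continuous because [a] vanishes where the 2-cell meets other cells, on the
    two rays and at the apex; the outer side [t = 1] is left free. *)
Lemma edge_bump e (a : R * R -> R) : continuous a ->
  (forall t, a (0, t) = 0) -> (forall t, a (1, t) = 0) -> (forall s, a (s, 0) = 0) ->
  exists f : K -> R, [/\ continuous f,
    forall s t, 0 <= s <= 1 -> 0 <= t <= 1 -> f (edge_point e s t) = a (s, t),
    forall e' s t, e' != e -> f (edge_point e' s t) = 0 &
    forall v t, f (vertex_ray v t) = 0].
Proof.
move=> ca a0 a1 ab.
have [||||||f [cf fe fv]] := @glue_cone R G R
  (fun e' z => if e' == e then a z else 0) (fun _ _ => 0).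
- by move=> e' t _; case: ifP.
- by move=> e' t _; case: ifP.
- by move=> e' _ s _; case: ifP.
- by [].
- by move=> e'; case: (e' == e) => //; exact: cst_continuous.
- by move=> v; exact: cst_continuous.
exists f; split=> //.
- by move=> s t s01 t01; rewrite fe // eqxx.
- move=> e' s t ne; rewrite edge_point_clamp fe ?clampR_bounds //.
  by rewrite (negPf ne).
- by move=> v t; rewrite vertex_ray_clamp fv ?clampR_bounds.
Qed.

Lemma cone_height : exists f : K -> R, [/\ continuous f,
    forall e s t, 0 <= s <= 1 -> 0 <= t <= 1 -> f (edge_point e s t) = t &
    forall v t, 0 <= t <= 1 -> f (vertex_ray v t) = t].
Proof.
apply: (@glue_cone R G R (fun _ z => z.2) (fun _ t => t)) => //.
- by move=> e; exact: continuous_snd.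
- by move=> v t; exact: cvg_id.
Qed.

(** The 2-cell parametrised in the direction of travel. *)
Definition step_point st s t : K :=
  edge_point st.1 (if st.2 then s else 1 - s) t.

Lemma continuous_reflect (S : topologicalType) (f : S -> R) :
  continuous f -> continuous (fun x => 1 - f x).
Proof. by move=> cf x; apply: cvgB; [exact: cvg_cst | exact: cf]. Qed.

Lemma step_point_continuous st :
  continuous (fun z : R * R => step_point st z.1 z.2).
Proof.
rewrite /step_point; case: st.2; first exact: edge_point_continuous.
apply: (continuous_compose (f := fun z : R * R => (1 - z.1, z.2))
  (@edge_point_continuous R G st.1)).
apply: continuous_pairmap; last exact: continuous_snd.
exact/continuous_reflect/continuous_fst.
Qed.

Lemma step_point0 st t : step_point st 0 t = vertex_ray (step_from st) t.
Proof.
by rewrite /step_point /step_from; case: st.2;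
  rewrite ?subr0 ?edge_point0 ?edge_point1.
Qed.

Lemma step_point1 st t : step_point st 1 t = vertex_ray (step_to st) t.
Proof.
by rewrite /step_point /step_to; case: st.2;
  rewrite ?subrr ?edge_point0 ?edge_point1.
Qed.

Lemma step_point_apex st s v : step_point st s 0 = vertex_ray v 0.
Proof. exact: edge_point_apex. Qed.

(** Zero on the two rays and at the apex, positive inside the 2-cell and on its open outer edge. *)
Definition tent (z : R * R) : R := z.2 * (z.1 * (1 - z.1)).

Lemma tent_continuous : continuous tent.
Proof.
move=> z; apply: cvgM; first exact: continuous_snd.
apply: cvgM; first exact: continuous_fst.
by apply: continuous_reflect => z'; exact: continuous_fst.
Qed.

Lemma tent_left t : tent (0, t) = 0.
Proof. by rewrite /tent /= mul0r mulr0. Qed.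

Lemma tent_right t : tent (1, t) = 0.
Proof. by rewrite /tent /= subrr !mulr0. Qed.

Lemma tent_bottom s : tent (s, 0) = 0.
Proof. by rewrite /tent /= mul0r. Qed.

Lemma step_bump st (a : R * R -> R) : continuous a ->
  (forall t, a (0, t) = 0) -> (forall t, a (1, t) = 0) -> (forall s, a (s, 0) = 0) ->
  exists f : K -> R, [/\ continuous f,
    forall s t, 0 <= s <= 1 -> 0 <= t <= 1 -> f (step_point st s t) = a (s, t),
    forall e s t, e != st.1 -> f (edge_point e s t) = 0 &
    forall v t, f (vertex_ray v t) = 0].
Proof.
move=> ca a0 a1 ab.
have [||||f [cf fe fe' fv]] := @edge_bump st.1
  (fun z => a (if st.2 then z.1 else 1 - z.1, z.2)).
- apply: (continuous_compose ca); apply: continuous_pairmap; last exact: continuous_snd.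
  case: st.2; last apply: continuous_reflect; exact: continuous_fst.
- by move=> t /=; case: st.2; rewrite ?subr0.
- by move=> t /=; case: st.2; rewrite ?subrr.
- by move=> t.
exists f; split=> // s t s01 t01; rewrite fe //=.
  by case: st.2; rewrite // opprB addrC subrK.
by case: st.2 => //; move: s01 => /andP[? ?]; apply/andP; lra.
Qed.

(* The disc (a square whose bottom edge is collapsed to the apex) spanned by
   the cone over a walk, the k-th step being traversed for z.1 in [k, k + 1]. *)
Fixpoint walk_cone (x : vertex G) (p : seq (step G)) (z : R * R) : K :=
  if p is st :: p' then
    if z.1 - 1 <= 0 then step_point st z.1 z.2
    else walk_cone (step_to st) p' (z.1 - 1, z.2)
  else vertex_ray x z.2.

Section WalkCone.
Variable y : vertex G.

Lemma walk_cone0 x p t : is_walk x p y -> walk_cone x p (0, t) = vertex_ray x t.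
Proof. by case: p => //= st p /andP[/eqP<- _]; rewrite sub0r lerN10 step_point0. Qed.

Lemma walk_cone_size x p t : is_walk x p y ->
  walk_cone x p ((size p)%:R, t) = vertex_ray y t.
Proof.
elim: p x => [|st p IH] x /=; first by move=> /eqP->.
move=> /andP[_ w]; rewrite -addn1 natrD addrK pmulrn; case: p w IH => [|st' p] w IH.
  by rewrite /= add0r lexx step_point1; case/eqP: w => ->.
by rewrite leNgt ltr0n /= -(IH _ w).
Qed.

Lemma walk_cone_apex x p s v : walk_cone x p (s, 0) = vertex_ray v 0.
Proof.
elim: p x s => [|st p IH] x s /=; first exact: vertex_ray_apex.
by case: ifP => _; [exact: step_point_apex | exact: IH].
Qed.

Lemma walk_cone_in_pair (N : {set vertex G}) x p s :
  cone_pair R [set vertex_point R v | v in [set v | v \in N]] (walk_cone x p (s, 1)).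
Proof.
elim: p x s => [|st p IH] x s /=; first by apply: vertex_ray_in_pair; rewrite eqxx orbT.
by case: ifP => _; [exact: edge_point_in_pair | exact: IH].
Qed.

Lemma walk_cone_continuous x p : is_walk x p y -> continuous (walk_cone x p).
Proof.
elim: p x => [|st p IH] x /=.
  move=> _; apply: (continuous_compose (@vertex_ray_continuous R G x)).
  exact: continuous_snd.
move=> /andP[_ w].
have cshift : continuous (fun z : R * R => z.1 - 1).
  by move=> z; apply: cvgB; [exact: continuous_fst | exact: cvg_cst].
apply: continuous_paste => //.
- exact: step_point_continuous.
- apply: (continuous_compose (IH _ w)); apply: continuous_pairmap => //.
  exact: continuous_snd.
- move=> [s t] /= s1; rewrite s1 walk_cone0 // -step_point1.
  by move/eqP: s1; rewrite subr_eq0 => /eqP->.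
Qed.

Section Bump.
Variables (st : step G) (a : R * R -> R) (f : K -> R).
Hypothesis a0 : forall t, a (0, t) = 0.
Hypothesis fE : forall s t, 0 <= s <= 1 -> 0 <= t <= 1 -> f (step_point st s t) = a (s, t).
Hypothesis f_other : forall e s t, e != st.1 -> f (edge_point e s t) = 0.
Hypothesis f_vertex : forall v t, f (vertex_ray v t) = 0.

Lemma bump_walk_other x p z : st.1 \notin edges_of p -> f (walk_cone x p z) = 0.
Proof.
elim: p x z => [|st' p IH] x z //=; rewrite inE negb_or => /andP[ne np].
by case: ifP => _; [apply: f_other; rewrite eq_sym | exact: IH].
Qed.

(** The disc enters the 2-cell of [st] only during that one step, the unit interval starting at
    [size p]. *)
Lemma bump_walk x p q s t : st.1 \notin edges_of p -> st.1 \notin edges_of q ->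
  0 <= s -> 0 <= t <= 1 ->
  f (walk_cone x (p ++ st :: q) (s, t)) =
  if 0 <= s - (size p)%:R <= 1 then a (s - (size p)%:R, t) else 0.
Proof.
move=> + nq + t01; elim: p x s => [|st' p IH] x s /=.
  move=> _ s0; rewrite subr0 s0 subr_le0 /=; case: ifP => s1.
    by rewrite fE ?s0.
  exact: bump_walk_other.
rewrite inE negb_or eq_sym => /andP[ne np] s0; rewrite subr_le0 -addn1 natrD.
case: ifP => s1.
  (* The earlier step meets the interval of [st] only at the seam, where [a] vanishes. *)
  rewrite f_other //; case: ifP => // /andP[h _].
  have -> : s - ((size p)%:R + 1) = 0 by have := ler0n R (size p); lra.
  by rewrite a0.
rewrite IH //=; last by rewrite subr_ge0 ltW // ltNge s1.
by rewrite opprD addrA addrAC.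
Qed.

End Bump.
End WalkCone.
End ConeMaps.

(** * Discs cover the open 2-cells that they traverse once *)

Section Hits.
Context {R : realType} {G : graph}.
Variable N : {set vertex G}.
Local Notation K := (cone R (realization R G)).
Local Notation M :=
  (cone_pair R [set vertex_point R v | v in [set v | v \in N]]).
Variable f : K -> K.
Hypothesis cf : continuous f.
Hypothesis fM : forall k, M k -> f k = k.

(** If the point were missed, the image of the disc would give a nowhere zero map of the square into
    the plane, of the kind that [winding_absurd] excludes. *)
Lemma walk_cone_hits x y p e s t : is_walk x p y -> e \in edges_of p ->
  uniq (edges_of p) -> x = y \/ (x \in N /\ y \in N) ->
  0 < s < 1 -> 0 < t < 1 ->
  exists z, [/\ 0 <= z.1 <= (size p)%:R, 0 <= z.2 <= 1 &
    f (walk_cone x p z) = edge_point e s t].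
Proof.
move=> w ep up xy s01 t01.
have [p1 [d [p2 [pE np1 np2]]]] := edges_of_split ep up.
pose st : step G := (e, d); pose r : R := if d then s else 1 - s.
have r01 : 0 < r < 1.
  by move: s01; rewrite /r; case: (d) => // /andP[? ?]; apply/andP; lra.
have -> : edge_point e s t = step_point st r t.
  by rewrite /step_point /st /r /=; case: (d) => //; rewrite opprB addrC subrK.
have [bw [cw wE w' wv]] := @step_bump R G st _ (@tent_continuous R)
  (@tent_left R) (@tent_right R) (@tent_bottom R).
(* The map (twist, tent / tent (r, t) - 1) into the plane vanishes only at the
   point (r, t) of the 2-cell, and is constant off this 2-cell. *)
pose twist (z : R * R) := tent z * (z.1 - r).
have [||||bv [cv vE v' vv]] := @step_bump R G st twist; rewrite /twist /=.
- move=> z; apply: cvgM; first exact: tent_continuous.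
  by apply: cvgB; [exact: continuous_fst | exact: cvg_cst].
- by move=> ?; rewrite tent_left mul0r.
- by move=> ?; rewrite tent_right mul0r.
- by move=> ?; rewrite tent_bottom mul0r.
have twist0 u : twist (0, u) = 0 by rewrite /twist tent_left mul0r.
pose n : R := (size p)%:R; pose m : R := (size p1)%:R.
have m0 : 0 <= m by exact: ler0n.
have mn : m + 1 <= n by rewrite /n /m pE size_cat /= natrD lerD2l ler1n.
(* The inverse of [tent (r, t)], so that [c * bw - 1] vanishes at the missed point. *)
pose c := (t * (r * (1 - r)))^-1.
have c0 : 0 < c.
  rewrite invr_gt0; move: r01 t01 => /andP[? ?] /andP[? ?].
  by rewrite !mulr_gt0 // subr_gt0.
pose D (z : R * R) := f (walk_cone x p (n * z.1, z.2)).
have cD : continuous D.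
  apply: (continuous_compose cf).
  apply: (continuous_compose (f := fun z : R * R => (n * z.1, z.2))
    (walk_cone_continuous w)).
  apply: continuous_pairmap; last exact: continuous_snd.
  by move=> z; apply: cvgM; [exact: cvg_cst | exact: continuous_fst].
apply: contrapT => no.
have top z : 0 <= z -> D (z, 1) = walk_cone x p (n * z, 1).
  by move=> z0; rewrite /D fM //=; exact: walk_cone_in_pair.
(* The sides of the disc run along the rays of [x] and [y]: one and the same ray for a closed walk,
   otherwise rays fixed by [f], where [h] is zero. *)
have side (h : K -> R) u : (forall v t, h (vertex_ray v t) = 0) ->
    h (D (0, u)) = h (D (1, u)).
  move=> hv; rewrite /D /= mulr0 mulr1 (walk_cone0 _ w) (walk_cone_size _ w).
  case: xy => [->//|[xN yN]].
  by rewrite !fM ?hv //; apply: vertex_ray_in_pair; rewrite ?xN ?yN.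
have bot (h : K -> R) u : h (D (u, 0)) = h (D (0, 0)).
  by rewrite /D /= !(walk_cone_apex x p _ x).
have n0 : 0 < n by lra.
have Dbump (h : K -> R) a : (forall u, a (0, u) = 0) ->
    (forall s t, 0 <= s <= 1 -> 0 <= t <= 1 -> h (step_point st s t) = a (s, t)) ->
    (forall e s t, e != st.1 -> h (edge_point e s t) = 0) ->
    (forall v t, h (vertex_ray v t) = 0) ->
    forall u, 0 <= u ->
    h (D (u, 1)) = if 0 <= n * u - m <= 1 then a (n * u - m, 1) else 0.
  move=> a0 hE h' hv u u0; rewrite top // pE (bump_walk (st := st) (a := a)) //.
    by rewrite mulr_ge0 // ltW.
  by rewrite lexx ler01.
(* On the top, the upper half-plane is reached only while [e] is traversed, and there the first
   coordinate has the sign of [n * u - m - r]; hence the crossing at [(m + r) / n]. *)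
have Dw u : 0 <= u -> 0 < c * bw (D (u, 1)) - 1 ->
    0 < (n * u - m) * (1 - (n * u - m)) /\
    bv (D (u, 1)) = (n * u - m) * (1 - (n * u - m)) * (n * u - m - r).
  move=> u0; rewrite (Dbump _ _ (@tent_left R) wE w' wv) // /tent /=.
  rewrite (Dbump _ _ twist0 vE v' vv) // /twist /tent /=.
  case: ifP => _; last by rewrite mulr0; lra.
  rewrite !mul1r => h; split=> //; rewrite -(pmulr_rgt0 _ c0); lra.
apply: (@winding_absurd R (fun z => bv (D z)) (fun z => c * bw (D z) - 1)
  ((m + r) / n)).
- exact: (continuous_compose cv cD).
- move=> z; apply: cvgB; last exact: cvg_cst.
  by apply: cvgM; [exact: cvg_cst | exact: (continuous_compose cw cD)].
(* Off the 2-cell of [e] the second coordinate is -1. On it, a zero has nonzero tent, so the first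
   coordinate forces [r' = r] and the second then forces [t' = t]. *)
- move=> u1 u2 u1P u2P [v0 w0]; apply: no; exists (n * u1, u2) => /=; split => //.
    by move: u1P => /andP[? ?]; rewrite mulr_ge0 ?ler0n //= ler_piMr ?ler0n.
  move: v0 w0; rewrite /D /=.
  elim/(@cone_ind R): (f _) => [e' s' t' s'P t'P|v t' _]; last first.
    by rewrite wv mulr0 sub0r => _ /eqP; rewrite oppr_eq0 oner_eq0.
  have [->|ne] := eqVneq e' e; last first.
    by rewrite w' // mulr0 sub0r => _ /eqP; rewrite oppr_eq0 oner_eq0.
  pose r' := if d then s' else 1 - s'.
  have eE : edge_point e s' t' = step_point st r' t'.
    by rewrite /step_point /st /r' /=; case: (d); rewrite // opprB addrC subrK.
  have r'P : 0 <= r' <= 1.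
    by move: s'P; rewrite /r'; case: (d) => // /andP[? ?]; apply/andP; lra.
  rewrite eE vE // wE // /twist /= => /eqP; rewrite mulf_eq0 => /orP[/eqP->|].
    by rewrite mulr0 sub0r => /eqP; rewrite oppr_eq0 oner_eq0.
  rewrite subr_eq0 => /eqP-> /eqP; rewrite subr_eq0 /tent /= => /eqP ct.
  congr (step_point _ _ _).
  have Y0 : r * (1 - r) != 0.
    by apply: contraTneq c0 => Y; rewrite /c Y mulr0 invr0 ltxx.
  apply: (mulIf Y0); apply: (mulfI (lt0r_neq0 c0)).
  rewrite ct /c mulVf // mulf_neq0 //; move: t01; lra.
- by move=> u _; apply: side.
- by move=> u _; rewrite (side bw).
- by move=> u _; apply: bot.
- by move=> u _; rewrite (bot bw).
- rewrite divr_gt0 ?ltr_pdivrMr //=; lra.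
- have p00 : 0 <= (m + r) / n by rewrite divr_ge0 //; lra.
  have pm : n * ((m + r) / n) - m = r.
    by rewrite mulrC divfK ?gt_eqF // addrC addKr.
  rewrite (Dbump _ _ (@tent_left R) wE w' wv) // /tent /=.
  rewrite pm ifT; last lra.
  have Y0 : r * (1 - r) != 0.
    by apply: contraTneq c0 => Y; rewrite /c Y mulr0 invr0 ltxx.
  (* The value is [t^-1 - 1], positive because [t < 1]. *)
  rewrite /c mul1r invfM -mulrA mulVf // mulr1 subr_gt0 invf_gt1; lra.
- move=> u /andP[u0 up0] /Dw[//|X ->]; rewrite pmulr_rlt0 //.
  by move: up0; rewrite ltr_pdivlMr // mulrC; lra.
- move=> u /andP[up0 u1] /Dw[|X ->].
    by apply: le_trans up0; rewrite divr_ge0 //; lra.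
  rewrite pmulr_rge0 //.
  by move: up0; rewrite ler_pdivrMr // mulrC; lra.
Qed.
End Hits.

(** * Points of the rays *)

Section Rays.
Context {R : realType} {G : graph}.
Local Notation K := (cone R (realization R G)).

(* The squares make the function vanish only at the ends when e is a loop
   at v. *)
Definition vertex_dist (v : vertex G) (e : edge G) (s : R) : R :=
  1 - (source e == v)%:R * (1 - s) ^+ 2 - (target e == v)%:R * s ^+ 2.

Lemma vertex_dist_ge0 v e s : 0 <= s <= 1 -> 0 <= vertex_dist v e s.
Proof. by rewrite /vertex_dist => /andP[? ?]; do 2 case: eqP => _ /=; nra. Qed.

Lemma vertex_dist_eq0 v e s : 0 <= s <= 1 -> vertex_dist v e s = 0 ->
  (s = 0 /\ source e = v) \/ (s = 1 /\ target e = v).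
Proof.
rewrite /vertex_dist => /andP[s0 s1].
case: eqP => [sv|_] /=; case: eqP => [tv|_] /= => h.
- have /eqP : s * (1 - s) = 0 by nra.
  by rewrite mulf_eq0 subr_eq0 => /orP[/eqP|/eqP] ?; [left|right].
- have /eqP : s * (2 - s) = 0 by nra.
  by rewrite mulf_eq0 subr_eq0 => /orP[/eqP ?|/eqP ?]; [left|exfalso; lra].
- have /eqP : (1 - s) * (1 + s) = 0 by nra.
  by rewrite mulf_eq0 subr_eq0 => /orP[/eqP ?|/eqP ?]; [right|exfalso; lra].
- exfalso; lra.
Qed.

Lemma vertex_dist_continuous v e : continuous (vertex_dist v e).
Proof.
have csqr (g : R -> R) : continuous g -> continuous (fun s => g s ^+ 2).
  by move=> cg; exact: (continuous_compose (@exprn_continuous R 2) cg).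
have cid : continuous (@id R) by move=> s; exact: cvg_id.
move=> s; apply: cvgB; last first.
  by apply: cvgM; [exact: cvg_cst | exact: (csqr id)].
apply: cvgB; first exact: cvg_cst.
apply: cvgM; first exact: cvg_cst.
by apply: (csqr (fun r => 1 - r)); exact: continuous_reflect.
Qed.

(** A substitute for the distance to a point of a ray; the factor [t] makes it well defined at the
    apex. *)
Lemma ray_distance v (t0 : R) : 0 <= t0 <= 1 -> exists h : K -> R,
  [/\ continuous h, forall k, 0 <= h k, forall k, h k = 0 -> k = vertex_ray v t0 &
    forall e s t, 0 <= s <= 1 -> 0 <= t <= 1 ->
      h (edge_point e s t) = t * vertex_dist v e s + `|t - t0|].
Proof.
move=> t01.
have cabs : continuous (fun t : R => `|t - t0|).
  apply: (continuous_compose (g := fun r : R => `|r|)).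
    exact: norm_continuous.
  by move=> t; apply: cvgB; [exact: cvg_id | exact: cvg_cst].
have [||||||h [ch he hv]] := @glue_cone R G R
  (fun e z => z.2 * vertex_dist v e z.1 + `|z.2 - t0|)
  (fun w t => t * (w != v)%:R + `|t - t0|).
- move=> e t _ /=; congr (_ * _ + _).
  by rewrite /vertex_dist; case: eqP => _ /=; ring.
- move=> e t _ /=; congr (_ * _ + _).
  by rewrite /vertex_dist; case: (target e == v) => /=; ring.
- by move=> e w s _; rewrite !mul0r.
- by move=> u w; rewrite !mul0r.
- move=> e z; apply: cvgD; last first.
    exact: (continuous_compose cabs (@continuous_snd _ _)).
  apply: cvgM; first exact: continuous_snd.
  exact: (continuous_compose (@vertex_dist_continuous v e) (@continuous_fst _ _)).
- move=> w t; apply: cvgD; last exact: cabs.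
  by apply: cvgM; [exact: cvg_id | exact: cvg_cst].
exists h; split=> //.
- elim/(@cone_ind R) => [e s t s1 t1|w t t1].
    by rewrite he // addr_ge0 // mulr_ge0 ?vertex_dist_ge0 //; case/andP: t1.
  by rewrite hv // addr_ge0 // mulr_ge0 ?ler0n //; case/andP: t1.
- elim/(@cone_ind R) => [e s t s1 t1|w t t1].
    have t_ge0 : 0 <= t by case/andP: t1.
    rewrite he // => /eqP; rewrite paddr_eq0 ?mulr_ge0 ?vertex_dist_ge0 //=.
    rewrite normr_eq0 subr_eq0 mulf_eq0 => /andP[/orP[/eqP->|/eqP d0] /eqP<-].
      exact: edge_point_apex.
    have [[-> <-]|[-> <-]] := vertex_dist_eq0 s1 d0.
      exact: edge_point0.
    exact: edge_point1.
  have t_ge0 : 0 <= t by case/andP: t1.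
  rewrite hv // => /eqP; rewrite paddr_eq0 ?mulr_ge0 ?ler0n //=.
  rewrite normr_eq0 subr_eq0 mulf_eq0 => /andP[/orP[/eqP->|wv] /eqP<-].
    exact: vertex_ray_apex.
  by have [->//|ne] := eqVneq w v; move: wv; rewrite ne oner_eq0.
Qed.

(** The point is a limit of points of the open 2-cell of [e], which [g] attains on a compact
    rectangle. So the minimum of [h] along [g] there cannot be positive. *)
Lemma ray_hit_of_edge (n : R) (g : R * R -> K) v e (t0 : R) :
  0 <= n -> continuous g ->
  (forall s t, 0 < s < 1 -> 0 < t < 1 ->
    exists z, [/\ 0 <= z.1 <= n, 0 <= z.2 <= 1 & g z = edge_point e s t]) ->
  0 <= t0 < 1 -> [\/ t0 = 0, source e = v | target e = v] ->
  exists z, g z = vertex_ray v t0.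
Proof.
move=> n0 cg hits t01 inc.
have [|h [ch h0 hz he]] := @ray_distance v t0.
  by case/andP: t01 => -> /ltW.
pose Q := `[0 : R, n]%classic `*` `[0 : R, 1]%classic.
have cQ : compact Q by apply: compact_setX; exact: segment_compact.
have Q0 : Q !=set0 by exists (0, 0); split; rewrite /= in_itv /= ?lexx ?ler01 ?n0.
have chg : {within Q, continuous (fun z => h (g z))}.
  by apply: continuous_subspaceT; exact: (continuous_compose ch cg).
have [c cQ' cmin] := compact_EVT_min Q0 cQ chg.
exists c; apply: hz; apply/eqP; rewrite eq_le h0 andbT leNgt; apply/negP => hc.
suff [s [t [s1 t1 hst]]] : exists s t, [/\ 0 < s < 1, 0 < t < 1 &
    h (edge_point e s t) < h (g c)].
  have [z [z1 z2 gz]] := hits s t s1 t1.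
  have /cmin : z \in Q by rewrite inE; split; rewrite /= in_itv.
  by rewrite gz leNgt hst.
(* Each approximating point below has [h] at most [2 * d], which is less than the supposed
   minimum. *)
pose d := Num.min (h (g c) / 3) 2^-1.
have d0 : 0 < d by rewrite /d lt_min invr_gt0 ltr0n andbT divr_gt0.
have d1 : d < 1 by rewrite /d gt_min; apply/orP; right; lra.
have dh : 2 * d < h (g c).
  have : d <= h (g c) / 3 by rewrite /d ge_min lexx.
  lra.
have [t00|t00] := eqVneq t0 0.
  exists 2^-1, d; rewrite he; [|lra|lra]; split; [lra|lra|].
  rewrite t00 subr0 gtr0_norm // /vertex_dist.
  by do 2 case: (_ == _) => /=; nra.
have t0p : 0 < t0 by rewrite lt_neqAle eq_sym t00; case/andP: t01.
have t0l : t0 < 1 by case/andP: t01.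
case: inc => [|sv|tv]; first by move/eqP; rewrite (negPf t00).
- exists d, t0; rewrite he; [|lra|lra]; split; [lra|lra|].
  rewrite subrr normr0 addr0 /vertex_dist sv eqxx.
  by case: (_ == _) => /=; nra.
- exists (1 - d), t0; rewrite he; [|lra|lra]; split; [lra|lra|].
  rewrite subrr normr0 addr0 /vertex_dist tv eqxx.
  by case: (_ == _) => /=; nra.
Qed.

(** The ray of an isolated vertex meets the rest only at the apex, so height counted positively on
    it and negatively elsewhere is continuous. Along the image of the path from [w] over the apex to
    [v] it runs from -1 to 1. *)
Lemma ray_hit_isolated (f : K -> K) v w (t0 : R) :
  continuous f -> w != v ->
  (forall e, source e <> v /\ target e <> v) ->
  f (vertex_ray v 1) = vertex_ray v 1 -> f (vertex_ray w 1) = vertex_ray w 1 ->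
  0 <= t0 <= 1 -> exists k, f k = vertex_ray v t0.
Proof.
move=> cf wv iso fv fw t01.
have copp : continuous (fun t : R => - t) by move=> t; apply: cvgN; exact: cvg_id.
have [||||||h [ch he hv]] := @glue_cone R G R
  (fun e z => - z.2) (fun u t => if u == v then t else - t).
- by move=> e t _; case: eqP => // /(iso e).1.
- by move=> e t _; case: eqP => // /(iso e).2.
- by move=> e u s _; rewrite oppr0; case: ifP.
- by move=> u u'; rewrite oppr0; do 2 case: ifP.
- by move=> e; exact: (continuous_compose copp (@continuous_snd _ _)).
- by move=> u; case: (u == v) => // t; exact: cvg_id.
pose path u := if u <= 0 then vertex_ray w (- u) else vertex_ray v u : K.
have cpath : continuous path.
  apply: (@continuous_paste R _ _ id); first by move=> t; exact: cvg_id.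
  - exact: (continuous_compose (@vertex_ray_continuous R G w) copp).
  - exact: vertex_ray_continuous.
  - by move=> _ ->; rewrite oppr0; exact: vertex_ray_apex.
have path1 : path (-1) = vertex_ray w 1 by rewrite /path lerN10 opprK.
have path2 : path 1 = vertex_ray v 1 by rewrite /path leNgt ltr01.
have [|||u _ hu] := @IVT R (fun u => h (f (path u))) (-1) 1 t0.
- lra.
- apply: continuous_subspaceT.
  exact: (continuous_compose ch (continuous_compose cf cpath)).
- rewrite path1 path2 fv fw !hv ?ler01 ?lexx //.
  by rewrite eqxx (negPf wv) min_l ?max_r; lra.
(* Off the ray of [v] the value is [- t], so it equals [t0 >= 0] only at the apex. *)
exists (path u); move: hu; elim/(@cone_ind R): (f _) => [e s t s1 t1|u' t t1].
  rewrite he //= => tt0; have -> : t = 0 by lra.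
  have -> : t0 = 0 by lra.
  exact: edge_point_apex.
rewrite hv //; case: eqP => [-> -> //|_ tt0].
have -> : t = 0 by lra.
have -> : t0 = 0 by lra.
exact: vertex_ray_apex.
Qed.
End Rays.

(** * The collapsing map *)

Section Collapse.
Context {R : realType} {G : graph}.
Local Notation K := (cone R (realization R G)).
Variables (e : edge G) (d : bool) (B : {set vertex G}).
Let st : step G := (e, d).
Hypothesis fromB : step_from st \notin B.
Hypothesis toB : step_to st \in B.
Hypothesis closedB : forall e', e' != e -> (source e' \in B) = (target e' \in B).

(* For u in [0, 3], the loop apex - a - b - apex around the triangle over e. *)
Definition rim (u : R) : K :=
  if u - 1 <= 0 then vertex_ray (step_from st) u
  else if u - 2 <= 0 then step_point st (u - 1) 1
  else vertex_ray (step_to st) (3 - u).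

Let cid : continuous (@id R).
Proof. by move=> u; exact: cvg_id. Qed.

Let cshift (c : R) : continuous (fun u : R => u - c).
Proof. by move=> u; apply: cvgB; [exact: cvg_id | exact: cvg_cst]. Qed.

Let cscale (S : topologicalType) (c : R) (g : S -> R) :
  continuous g -> continuous (fun u => c * g u).
Proof. by move=> cg u; apply: cvgM; [exact: cvg_cst | exact: cg]. Qed.

Lemma rim_continuous : continuous rim.
Proof.
apply: continuous_paste; first exact: cshift.
- exact: vertex_ray_continuous.
- apply: continuous_paste; first exact: cshift.
  + apply: (continuous_compose (f := fun u : R => (u - 1, 1 : R))
      (@step_point_continuous R G st)).
    by apply: continuous_pairmap; [exact: cshift | exact: cst_continuous].
  + apply: (continuous_compose (f := fun u : R => 3 - u)
      (@vertex_ray_continuous R G _)).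
    by move=> u; apply: cvgB; [exact: cvg_cst | exact: cvg_id].
  + move=> u u2; have -> : u = 2 by lra.
    have -> : 2 - 1 = 1 :> R by lra.
    have -> : 3 - 2 = 1 :> R by lra.
    exact: step_point1.
- move=> u u1; have -> : u = 1 by lra.
  by rewrite subrr ifT ?step_point0 //; lra.
Qed.

Lemma rim_from u : u <= 1 -> rim u = vertex_ray (step_from st) u.
Proof. by move=> u1; rewrite /rim subr_le0 u1. Qed.

Lemma rim_edge u : 1 <= u <= 2 -> rim u = step_point st (u - 1) 1.
Proof.
move=> /andP[u1 u2]; rewrite /rim !subr_le0 u2; case: ifP => // u1'.
have -> : u = 1 by lra.
by rewrite subrr step_point0.
Qed.

Lemma rim_to u : 2 <= u -> rim u = vertex_ray (step_to st) (3 - u).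
Proof.
move=> u2; rewrite /rim !subr_le0 ifF; last lra.
case: ifP => // u2'; have -> : u = 2 by lra.
have -> : 2 - 1 = 1 :> R by lra.
have -> : 3 - 2 = 1 :> R by lra.
exact: step_point1.
Qed.

(* In the parameter of [rim]: once around, then back from the apex to b. *)
Definition fold_time (t : R) : R := Num.min (6 * t) (4 - 2 * t).

Lemma fold_time_continuous : continuous fold_time.
Proof.
move=> t; apply: (@continuous_min R R (fun t => 6 * t) (fun t => 4 - 2 * t)).
  exact: cscale.
by apply: cvgB; [exact: cvg_cst | exact: cscale].
Qed.

(** Linear interpolation in the parameter of [rim], from the identity on the ray of a to the folded
    trip over b. At height 1 the parameter is [1 + z.1], so the outer edge is fixed. *)
Definition collapse_step (z : R * R) : K :=
  rim ((1 - z.1) * z.2 + z.1 * fold_time z.2).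

Lemma collapse_step_continuous : continuous collapse_step.
Proof.
apply: (continuous_compose rim_continuous) => z; apply: cvgD.
  apply: cvgM; last exact: continuous_snd.
  by apply: continuous_reflect => z'; exact: continuous_fst.
apply: cvgM; first exact: continuous_fst.
exact: (continuous_compose fold_time_continuous (@continuous_snd _ _)).
Qed.

(** The first half of the time goes once around the rim, of length 3, back to the apex; the second
    half runs [g] at double speed. *)
Definition collapse_ray (g : R -> K) (t : R) : K :=
  if t - 2^-1 <= 0 then rim (6 * t) else g (2 * t - 1).

Lemma collapse_step0 t : t <= 1 -> collapse_step (0, t) = vertex_ray (step_from st) t.
Proof. by move=> t1; rewrite /collapse_step /= subr0 mul1r mul0r addr0 rim_from. Qed.

Lemma collapse_step1 t : t <= 1 ->
  collapse_step (1, t) = collapse_ray (vertex_ray (step_to st)) t.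
Proof.
move=> t1; rewrite /collapse_step /collapse_ray /= subrr mul0r add0r mul1r subr_le0.
rewrite /fold_time; case: ifP => t2.
  by rewrite min_l //; lra.
rewrite min_r; last lra.
by rewrite rim_to; [congr vertex_ray; ring | lra].
Qed.

Lemma collapse_step_top s : 0 <= s <= 1 -> collapse_step (s, 1) = step_point st s 1.
Proof.
move=> s01; rewrite /collapse_step /fold_time /= min_r; last lra.
rewrite rim_edge; last lra.
by congr (step_point _ _ _); ring.
Qed.

Lemma collapse_step_apex s v : collapse_step (s, 0) = vertex_ray v 0.
Proof.
rewrite /collapse_step /fold_time /= !mulr0 min_l; last lra.
by rewrite mulr0 add0r rim_from //; exact: vertex_ray_apex.
Qed.

Lemma collapse_ray_apex g v : collapse_ray g 0 = vertex_ray v 0.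
Proof.
rewrite /collapse_ray mulr0 ifT; last lra.
by rewrite rim_from //; exact: vertex_ray_apex.
Qed.

Lemma collapse_ray_top g : collapse_ray g 1 = g 1.
Proof. by rewrite /collapse_ray ifF; [congr g; ring | lra]. Qed.

Let center : K := step_point st 2^-1 2^-1.

(** The tent function separates the centre from the rays and the other 2-cells, the height separates
    it from the outer edges. *)
Let center_avoided :
  [/\ forall v t, vertex_ray v t <> center,
      forall s, edge_point e s 1 <> center &
      forall e' s t, e' != e -> edge_point e' s t <> center].
Proof.
have h01 : 0 <= (2^-1 : R) <= 1 by lra.
have -> : center = edge_point e 2^-1 2^-1.
  by rewrite /center /step_point /st /=; case: (d) => //; congr edge_point; lra.
have [bw [_ wE we wv]] := @edge_bump R G e _ (@tent_continuous R)
  (@tent_left R) (@tent_right R) (@tent_bottom R).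
have [h [_ hE _]] := @cone_height R G.
split.
- by move=> v t /(congr1 bw); rewrite wv wE // /tent /=; lra.
- move=> s; rewrite edge_point_clamp => /(congr1 h).
  by rewrite !hE ?clampR_bounds // clampR_id ?lexx ?ler01 //; lra.
- by move=> e' s t ne /(congr1 bw); rewrite we // wE // /tent /=; lra.
Qed.

Lemma rim_avoids u : rim u <> center.
Proof.
have [cv ce _] := center_avoided.
by rewrite /rim; case: ifP => _; last case: ifP => _; [exact: cv|exact: ce|exact: cv].
Qed.

(** Three rules, for the triangle over [e], the cone over [B] and the rest, where the map is the
    identity. Every value is on the rim, on a ray or in another 2-cell, hence not the centre. *)
Lemma collapse_exists : exists f : K -> K,
  [/\ continuous f,
      forall e' s, 0 <= s <= 1 -> f (edge_point e' s 1) = edge_point e' s 1,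
      forall v t, 0 <= t <= 1 -> (v \notin B) || (t == 1) ->
        f (vertex_ray v t) = vertex_ray v t &
      forall k, f k <> step_point st 2^-1 2^-1].
Proof.
have cray g : continuous g -> (forall v, g 0 = vertex_ray v 0) ->
    continuous (collapse_ray g).
  move=> cg g0; apply: continuous_paste; first exact: cshift.
  - by apply: (continuous_compose rim_continuous); exact: cscale.
  - apply: (continuous_compose cg) => t; apply: cvgB; last exact: cvg_cst.
    exact: cscale.
  - move=> t t2; have -> : t = 2^-1 by lra.
    have -> : 2 * 2^-1 - 1 = 0 :> R by lra.
    by rewrite rim_to ?(g0 (step_to st)); [congr vertex_ray; lra | lra].
(* Testing the source suffices, since by [closedB] both ends of an edge other than [e] lie on the
   same side. *)
pose fe e' (z : R * R) : K :=
  if e' == e then collapse_step (if d then z.1 else 1 - z.1, z.2)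
  else if source e' \in B then collapse_ray (edge_point e' z.1) z.2
  else edge_point e' z.1 z.2.
pose fv v : R -> K := if v \in B then collapse_ray (vertex_ray v) else vertex_ray v.
have step_end (b : bool) t : t <= 1 ->
    collapse_step ((b : nat)%:R, t) = fv (if b then step_to st else step_from st) t.
  move=> t1; rewrite /fv; case: b; first by rewrite toB collapse_step1.
  by rewrite (negPf fromB) collapse_step0.
have [||||||f [cf fE fV]] := @glue_cone R G K fe fv.
- move=> e' t /andP[_ t1]; rewrite /fe /=; have [->|ne] := eqVneq.
    have := step_end (~~ d) t t1; rewrite /step_to /step_from /st /=.
    by case: (d) => /=; rewrite ?subr0.
  by rewrite /fv; case: ifP => _; rewrite /collapse_ray ?edge_point0.
- move=> e' t /andP[_ t1]; rewrite /fe /=; have [->|ne] := eqVneq.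
    have := step_end d t t1; rewrite /step_to /step_from /st /=.
    by case: (d) => /=; rewrite ?subrr.
  by rewrite /fv closedB //; case: ifP => _; rewrite /collapse_ray ?edge_point1.
- move=> e' v s _; have -> : fv v 0 = vertex_ray v 0.
    by rewrite /fv; case: ifP => _ //; exact: collapse_ray_apex.
  rewrite /fe /=; case: ifP => _; first exact: collapse_step_apex.
  by case: ifP => _; [exact: collapse_ray_apex | exact: edge_point_apex].
- move=> v w; have fv0 u : fv u 0 = vertex_ray v 0.
    rewrite /fv; case: ifP => _; first exact: collapse_ray_apex.
    exact: vertex_ray_apex.
  by rewrite !fv0.
- move=> e'; rewrite /fe; case: (e' == e).
    apply: (continuous_compose
      (f := fun z : R * R => (if d then z.1 else 1 - z.1, z.2))
      collapse_step_continuous).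
    apply: continuous_pairmap; last exact: continuous_snd.
    by case: (d); last apply: continuous_reflect; exact: continuous_fst.
  case: (_ \in B); last exact: edge_point_continuous.
  apply: (@continuous_paste R _ _ (fun z : R * R => z.2 - 2^-1)).
  + by move=> z; apply: cvgB; [exact: continuous_snd | exact: cvg_cst].
  + by apply: (continuous_compose rim_continuous); apply: cscale; exact: continuous_snd.
  + apply: (continuous_compose (f := fun z : R * R => (z.1, 2 * z.2 - 1))
      (@edge_point_continuous R G e')).
    apply: continuous_pairmap; first exact: continuous_fst.
    by move=> z; apply: cvgB; [apply: cscale; exact: continuous_snd | exact: cvg_cst].
  + move=> z z2; have -> : z.2 = 2^-1 by lra.
    have -> : 2 * 2^-1 - 1 = 0 :> R by lra.
    rewrite (edge_point_apex _ _ (step_to st)).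
    by rewrite rim_to; [congr vertex_ray; lra | lra].
- move=> v; rewrite /fv; case: ifP => _; last exact: vertex_ray_continuous.
  apply: cray; [exact: vertex_ray_continuous | exact: vertex_ray_apex].
exists f; split=> //.
- move=> e' s s01; rewrite fE ?lexx ?ler01 // /fe /=; have [->|ne] := eqVneq.
    have := collapse_step_top; rewrite /step_point /st /= => H.
    case: (d) H => H; rewrite H //; first by congr edge_point; ring.
    by move: s01 => /andP[? ?]; apply/andP; lra.
  by case: ifP => _ //; exact: collapse_ray_top.
- move=> v t t01; rewrite fV // /fv; case: ifP => //= _ /eqP->.
  exact: collapse_ray_top.
have [cv _ ce] := center_avoided.
elim/(@cone_ind R) => [e' s t s01 t01|v t t01].
  rewrite fE // /fe /=; have [_|ne] := eqVneq; first exact: rim_avoids.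
  case: ifP => _; last exact: ce.
  by rewrite /collapse_ray; case: ifP => _; [exact: rim_avoids | exact: ce].
rewrite fV // /fv; case: ifP => _; last exact: cv.
by rewrite /collapse_ray; case: ifP => _; [exact: rim_avoids | exact: cv].
Qed.

End Collapse.

(** The graph excluded by [hL] is a single vertex with [N] empty. Its cone is a segment and M one
    endpoint: the condition on edges is vacuous, yet the constant map to that endpoint is not
    surjective. *)
Theorem theorem24 (R : realType) (L : graph) (N : {set vertex L})
  (hL : ~ (#|vertex L| = 1%N /\ #|edge L| = 0%N /\ N = finset.set0)) :
  surjection_property
    (cone_pair R [set vertex_point R v | v in [set v | v \in N]])
  <->
  (forall e : edge L,
     (exists (x : vertex L) (p : seq (step L)),
        is_cycle x p /\ e \in edges_of p)
     \/
     (exists (x y : vertex L) (p : seq (step L)),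
        [/\ x \in N, y \in N, is_path x p y & e \in edges_of p])).
Proof.
split=> [surj e|H f cf fM].
  have [?|?|[d [fromB NB]]] := bridge_side e N; [by left|by right|exfalso].
  have toB : step_to ((e, d) : step L) \in side e d by rewrite inE connect0.
  have [f [cf fe fv fne]] :=
    @collapse_exists R L e d (side e d) fromB toB (@side_closed L e d).
  have [|k] := surj f cf _ (step_point ((e, d) : step L) 2^-1 2^-1); last exact: fne.
  apply: cone_pair_ind => [e' s s01|v t t01 vt]; first exact: fe.
  by apply: fv => //; case/orP: vt => [/NB->|->]; rewrite ?orbT.
have hits e : exists (n : R) (g : R * R -> cone R (realization R L)),
    [/\ 0 <= n, continuous g, forall s t, 0 < s < 1 -> 0 < t < 1 ->
      exists z, [/\ 0 <= z.1 <= n, 0 <= z.2 <= 1 & g z = edge_point e s t] &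
      forall z, exists k, f k = g z].
  have [x [y [p [w ep up xy]]]] := cycle_or_path_walk (H e).
  exists (size p)%:R, (fun z => f (walk_cone x p z)); split.
  - exact: ler0n.
  - exact: (continuous_compose cf (walk_cone_continuous w)).
  - by move=> s t; exact: (walk_cone_hits cf fM w ep up xy).
  - by move=> z; exists (walk_cone x p z).
have rays v t : 0 <= t <= 1 -> exists k, f k = vertex_ray v t.
  move=> t01; have [vt|] := boolP ((v \in N) || (t == 1)).
    by exists (vertex_ray v t); apply: fM; exact: vertex_ray_in_pair.
  rewrite negb_or => /andP[vN t1].
  have {}t1 : 0 <= t < 1 by move: t01; rewrite lt_neqAle t1.
  (* For [t = 0] any edge serves, the apex being in the closure of every 2-cell. *)
  have [[e inc]|noedge] :=
      pselect (exists e, [\/ t = 0, source e = v | target e = v]).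
    have [n [g [n0 cg ge gf]]] := hits e.
    by have [z <-] := ray_hit_of_edge n0 cg ge t1 inc; exact: gf.
  have iso e : source e <> v /\ target e <> v.
    by split=> ?; apply: noedge; exists e; [constructor 2|constructor 3].
  have [[w wv]|alone] := pselect (exists w, w != v).
    apply: (ray_hit_isolated cf wv iso) => //;
      by apply: fM; apply: vertex_ray_in_pair; rewrite eqxx orbT.
  (* What remains is a single vertex outside [N] and no edge, the case excluded by [hL]. *)
  have allv w : w = v.
    by apply/eqP; apply: contrapT => /negP wv; apply: alone; exists w.
  case: hL; split; [|split].
  - by apply/eqP/fintype1P; exists v.
  - by apply: eq_card0 => e; case: (iso e) => /(_ (allv _)).
  - by apply/setP => w; rewrite finset.in_set0 (allv w) (negPf vN).
elim/(@cone_ind R) => [e s t s01 t01|]; last exact: rays.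
have [->|s0] := eqVneq s 0; first by rewrite edge_point0; exact: rays.
have [->|s1] := eqVneq s 1; first by rewrite edge_point1; exact: rays.
have [->|t0] := eqVneq t 0.
  by rewrite (edge_point_apex e s (source e)); apply: rays; rewrite lexx ler01.
have [->|t1] := eqVneq t 1.
  by exists (edge_point e s 1); apply: fM; exact: edge_point_in_pair.
have [n [g [_ _ ge gf]]] := hits e.
have [||z [_ _ <-]] := ge s t; [| |exact: gf].
- by case/andP: s01 => ? ?; rewrite !lt_neqAle eq_sym s0 s1; apply/andP.
- by case/andP: t01 => ? ?; rewrite !lt_neqAle eq_sym t0 t1; apply/andP.
Qed.
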